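(* Let $q:[t_0,+\infty)\to\mathbb{R}$ be locally integrable. Suppose that for some $f\in\Omega$ the following two conditions are satisfied: 1) $\displaystyle \int_{t_0}^{+\infty}\exp\left\{\int_{t_0}^t\frac{d\tau}{f(\tau)}\int_{t_0}^\tau\left[2f(s)q(s)-\frac{f'(s)^2}{2f(s)}\right]ds\right\}dt=+\infty$; 7) $\displaystyle \liminf_{t\to+\infty}\left\{\frac{1}{f(t)}\int_{t_0}^t\left[2f(\tau)q(\tau)-\frac{f'(\tau)^2}{2f(\tau)}\right]d\tau-2\int_{t_0}^tq(\tau)\,d\tau\right\}=-\infty$. Then the equation $\phi''(t)+q(t)\phi(t)=0$, $t\ge t_0$, is oscillatory.
   Context: $t_0$ is a fixed real number. $\Omega$ denotes the set of all positive, absolutely continuous functions $f$ on $[t_0,+\infty)$ such that $(f')^2$ is locally integrable on $[t_0,+\infty)$. The equation $\phi''+q\phi=0$, $t\ge t_0$, is said to be oscillatory if every solution of it has arbitrarily large zeros. The notation $\int_{t_0}^t\frac{d\tau}{f(\tau)}\int_{t_0}^\tau g(s)\,ds$ means $\int_{t_0}^t\frac{1}{f(\tau)}\left(\int_{t_0}^\tau g(s)\,ds\right)d\tau$. *)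

(* Defs.v *)
From HB Require Import structures.
From mathcomp Require Import all_boot all_order all_algebra.
From mathcomp Require Import all_classical all_reals all_analysis.
Set Implicit Arguments.
Unset Strict Implicit.
Unset Printing Implicit Defensive.
Import Order.TTheory GRing.Theory Num.Theory.
Import numFieldNormedType.Exports.
Local Open Scope classical_set_scope.
Local Open Scope ring_scope.

(* All functions are total on R; only their values on [t0, +oo[ matter. *)

Definition abs_continuous_on (R : realType) (x y : R) (f : R -> R) : Prop :=
  forall e : R, 0 < e -> exists2 d : R, 0 < d &
    forall (n : nat) (a b : 'I_n -> R),
      (forall i, x <= a i /\ a i <= b i /\ b i <= y) ->
      trivIset [set: 'I_n] (fun i => `]a i, b i[%classic) ->
      \sum_(i < n) (b i - a i) < d ->
      \sum_(i < n) `|f (b i) - f (a i)| < e.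

(* On an unbounded interval, absolute continuity is meant on every compact
   subinterval. *)
Definition abs_continuous_from (R : realType) (t0 : R) (f : R -> R) : Prop :=
  forall b : R, t0 <= b -> abs_continuous_on t0 b f.

(* In the library, measurability of functions on R is Borel measurability.  A
   Lebesgue integrable function is one that agrees almost everywhere with a
   Borel integrable one; its [\int[lebesgue_measure]] is then the Lebesgue
   integral, because the library's integral is a supremum over the simple
   functions below and is insensitive to null sets even when the integrand is
   not itself Borel. *)
Definition lebesgue_integrable (R : realType) (D : set R) (g : R -> R) : Prop :=
  exists h : R -> R,
    {ae @lebesgue_measure R, forall s, D s -> g s = h s} /\
    (@lebesgue_measure R).-integrable D (EFin \o h).

(* The library's [locally_integrable] requires an open domain. *)
Definition locally_integrable_from (R : realType) (t0 : R) (g : R -> R) : Prop :=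
  forall b : R, t0 <= b -> lebesgue_integrable `[t0, b] g.

(* [derive1 f] is the two-sided derivative, meaningful at almost every t > t0;
   its values on the exceptional null set play no role. *)
Definition Omega (R : realType) (t0 : R) : set (R -> R) :=
  [set f | [/\ forall t, t0 <= t -> 0 < f t,
               abs_continuous_from t0 f &
               locally_integrable_from t0 (fun t => derive1 f t ^+ 2)]].

(* psi is the derivative of phi on [t0, +oo[, one-sided at t0. *)
Definition derivative_from (R : realType) (t0 : R) (phi psi : R -> R) : Prop :=
  forall t, t0 <= t ->
    (phi s - phi t) / (s - t) @[s --> within `[t0, +oo[ t^'] --> psi t.

(* Caratheodory solutions of phi'' + q phi = 0, as q is only locally
   integrable: phi is differentiable, phi' is locally absolutely continuous,
   and the equation holds almost everywhere. *)
Definition is_solution (R : realType) (t0 : R) (q phi : R -> R) : Prop :=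
  exists psi : R -> R,
    [/\ derivative_from t0 phi psi,
        abs_continuous_from t0 psi &
        {ae @lebesgue_measure R, forall t, t0 < t ->
           derivable psi t 1 /\ derive1 psi t + q t * phi t = 0}].

(* The zero solution satisfies the conclusion trivially, so there is no need
   to exclude it. *)
Definition oscillatory (R : realType) (t0 : R) (q : R -> R) : Prop :=
  forall phi : R -> R, is_solution t0 q phi ->
    forall T : R, exists t : R, [/\ t0 <= t, T <= t & phi t = 0].

(* Main.v *)
Require Import Defs.
From HB Require Import structures.
From mathcomp Require Import all_boot all_order all_algebra.
From mathcomp Require Import all_classical all_reals all_analysis.
From mathcomp Require Import measurable_realfun.
From mathcomp Require Import ring lra.
Import Order.TTheory GRing.Theory Num.Theory.
Import numFieldNormedType.Exports.
Local Open Scope classical_set_scope.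
Local Open Scope ring_scope.

(** Suppose that some solution phi has no zero from some point on.  Then
    phi' / phi solves the Riccati equation y' = - q - y ^ 2, but it is better to
    pass to the second solution u = phi * S, where S' = phi ^- 2 and S >= 1:
    it is also free of zeros, and (- 1 / S)' = u ^- 2 shows that u ^- 2 is
    integrable at infinity.  Write z = u' / u and p = u ^- 2, so that
    z' = - q - z ^ 2 almost everywhere, p' = - 2 z p, and p has a convergent
    integral [nonoscillatory_nonprincipal_riccati].

    Let G be the integral of g = 2 f q - f' ^ 2 / (2 f).  Completing the square,
    (2 f z + G)' = - (2 f z - f') ^ 2 / (2 f) <= 0 almost everywhere, hence
    2 f z + G is nonincreasing; so is z + \int q, of derivative - z ^ 2.  If
    2 f z + G were nonnegative everywhere, then G / f - 2 \int q would be at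
    least - 2 (z + \int q), which is bounded below, against the hypothesis on
    the lower limit.  So 2 f z + G becomes negative and stays so, which means
    G / f <= - 2 z = p' / p from some point on
    [weighted_mean_le_riccati].  Integrating, exp (\int G / f) is at most a
    constant multiple of p; its integral therefore converges
    [integral_exp_lt_pinfty], against the hypothesis that it diverges.

    Two facts on an absolutely continuous function W make the almost everywhere
    computations meaningful.  It is differentiable almost everywhere
    [ac_on_derivable_ae]: W is a difference of two monotone absolutely
    continuous functions, the Stieltjes measure of such a function is dominated
    by Lebesgue measure, and its Radon-Nikodym density is differentiated by
    Lebesgue's theorem.  And W is nonincreasing as soon as W' <= 0 almost
    everywhere [ac_on_nonincreasing].  Both facts rest on one covering argument,
    [ac_on_control]: an interval is cut into short cells, each of which either
    lies in an open set V of small measure or is harmless; the cells inside V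
    have small total length, so absolute continuity bounds what happens on
    them. *)

Set Implicit Arguments.
Unset Strict Implicit.
Unset Printing Implicit Defensive.

(** * Absolute continuity and coverings by short cells *)
#[local] Instance lebesgue_ae_filter (R : realType) :
  Filter (almost_everywhere (@lebesgue_measure R)) := ae_filter_ringOfSetsType _.

(** The step concerns all short cells [c, d] around x at once, so that it serves
    both to reach the supremum of the points attained and to pass beyond it. *)
Lemma real_induction (R : realType) (a b : R) (P : R -> Prop) :
  a <= b -> P a ->
  (forall x, a <= x <= b -> exists2 e, 0 < e & forall c d,
     [/\ a <= c, c <= x, x <= d & d <= b] -> d - c < e -> P c -> P d) ->
  P b.
Proof.
move=> ab Pa step.
pose S := [set x | a <= x <= b /\ P x].
have Sa : S a by split => //; rewrite lexx.
have ubS : ubound S b by move=> x [/andP[]].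
have hS : has_sup S by split; [exists a|exists b].
pose s := sup S.
have sb : s <= b by apply: ge_sup => //; exists a.
have as_ : a <= s by apply: sup_upper_bound.
have [|e e0 he] := step s; first by rewrite as_.
have [c [/andP[ac cb] Pc] sc] := sup_adherent (divr_gt0 e0 (ltr0n R 2)) hS.
have cs : c <= s by apply: sup_upper_bound => //; split => //; rewrite ac.
rewrite -/s in sc.
pose d := Num.min b (s + e / 2).
have sd : s <= d by rewrite le_min sb /=; lra.
have db : d <= b by rewrite ge_min lexx.
have dse : d <= s + e / 2 by rewrite ge_min lexx orbT.
have Pd : P d by apply: (he c d) => //; lra.
have ds : d <= s.
  by apply: sup_upper_bound => //; split => //; apply/andP; split => //; lra.
suff -> : b = d by [].
apply/eqP; move: ds; rewrite /d /Num.min; case: ltP => //.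
by move=> _ ?; exfalso; lra.
Qed.

(** Non-overlapping closed cells of [a, b], listed from left to right. The order
    makes it possible to refine or extend a family by concatenation. *)
Definition subdivision (R : realType) (a b : R) (s : seq (R * R)) : bool :=
  all (fun p => [&& a <= p.1, p.1 <= p.2 & p.2 <= b]) s &&
  pairwise (fun p q => p.2 <= q.1) s.

(** Absolute continuity, quantified over ordered lists of cells rather than over
    families indexed by ordinals. *)
Definition ac_on (R : realType) (a b : R) (f : R -> R) : Prop :=
  forall e : R, 0 < e -> exists2 d : R, 0 < d &
    forall s, subdivision a b s -> \sum_(p <- s) (p.2 - p.1) < d ->
      \sum_(p <- s) `|f p.2 - f p.1| < e.

Lemma abs_continuous_on_ac (R : realType) (a b : R) (f : R -> R) :
  abs_continuous_on a b f -> ac_on a b f.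
Proof.
move=> acf e e0; have [d d0 hd] := acf e e0; exists d => // s /andP[sab sord].
rewrite !(big_nth (0, 0)) !big_mkord => sd.
apply: (hd (size s) (fun i => (nth (0, 0) s i).1) (fun i => (nth (0, 0) s i).2)) => //.
- move=> i; have /and3P[] := all_nthP (0,0) sab i (ltn_ord i); by split.
- have key (i j : 'I_(size s)) x : (i < j)%N ->
    `](nth (0, 0) s i).1, (nth (0, 0) s i).2[%classic x ->
    `](nth (0, 0) s j).1, (nth (0, 0) s j).2[%classic x -> False.
    move=> ij /=; rewrite !in_itv /= => /andP[_ x1] /andP[x2 _].
    have := (pairwiseP (0, 0) sord) i j (ltn_ord i) (ltn_ord j) ij.
    by rewrite leNgt (lt_trans x2 x1).
  move=> i j _ _ [x [xi xj]]; apply/val_inj/eqP.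
  by case: (ltngtP i j) => // ij; exfalso; [apply: (key i j x)|apply: (key j i x)].
Qed.

(** The half-open cells of a subdivision are disjoint, whatever mass the measure
    nu gives to their endpoints. *)
Lemma sum_measure_subdivision_le (R : realType)
    (nu : {measure set (measurableTypeR R) -> \bar R}) (a b : R) s (U : set R) :
  measurable U -> subdivision a b s ->
  (forall p, p \in s -> `]p.1, p.2] `<=` U) ->
  (\sum_(p <- s) nu `]p.1, p.2]%classic <= nu U)%E.
Proof.
elim: s U => [|p s IH] U mU; first by rewrite big_nil.
rewrite /subdivision /= => /andP[/andP[pab sab] /andP[ps sord]] sU.
rewrite big_cons.
have mp : measurable (`]p.1, p.2]%classic : set R) by exact: measurable_itv.
have pU : `]p.1, p.2] `<=` U by apply: sU; rewrite mem_head.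
rewrite -[in leRHS](setDUK pU) measureU//; last 2 first.
  exact: measurableD.
  by rewrite setDIK.
rewrite leeD2l// IH//; first exact: measurableD.
  by rewrite /subdivision sab.
move=> q qs x xq; split; first by apply: (sU q) => //; rewrite in_cons qs orbT.
move: xq => /=; rewrite !in_itv /= => /andP[qx _] /andP[_ xp].
by have := allP ps q qs; rewrite leNgt (lt_le_trans qx xp).
Qed.

(** The variation of W over the part of [a, b] covered by a set U of small measure
    is small. Phi is any function that moves no faster than W, and that does
    not increase across the short cells that are not contained in U: real
    induction builds a list of cells contained in U that carries the whole
    increase of Phi. Taking for Phi the function W minus a small slope gives the
    monotonicity theorem; taking the distribution function of a measure on a
    closed set gives its domination by Lebesgue measure. *)
Lemma ac_on_control (R : realType) (a b : R) (W : R -> R) (e : R) :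
  a <= b -> ac_on a b W -> 0 < e ->
  exists2 d : R, 0 < d & forall U : set R, measurable U ->
    (@lebesgue_measure R U < d%:E)%E -> forall Phi : R -> R,
    (forall x y, a <= x -> x <= y -> y <= b -> Phi y - Phi x <= `|W y - W x|) ->
    (forall x, a <= x <= b -> exists2 r, 0 < r & forall y z,
      [/\ a <= y, y <= x, x <= z & z <= b] -> z - y < r ->
      `]y, z] `<=` U \/ Phi z <= Phi y) ->
    Phi b - Phi a <= e.
Proof.
move=> ab acW e0; have [d d0 hd] := acW e e0; exists d => // U mU Ud Phi PhiW loc.
pose Q x := exists s, [/\ subdivision a x s,
  forall p, p \in s -> `]p.1, p.2] `<=` U &
  Phi x - Phi a <= \sum_(p <- s) `|W p.2 - W p.1|].
have : a <= b /\ Q b.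
  apply: (@real_induction _ a b (fun x => a <= x /\ Q x)) => //.
    by split => //; exists [::]; split => //; rewrite big_nil subrr.
  move=> x xab; have [r r0 hr] := loc x xab; exists r => //.
  move=> c y [ac cx xy yb] ycr [_ [s [/andP[sab sord] sU sPhi]]].
  have cy := le_trans cx xy.
  split; first exact: le_trans cy.
  have say : all (fun p => [&& a <= p.1, p.1 <= p.2 & p.2 <= y]) s.
    by apply: sub_all sab => p /and3P[-> -> /= /le_trans->].
  have [|cyU|cyPhi] := hr c y _ ycr; first by split.
  - exists (rcons s (c, y)); split.
    + rewrite /subdivision all_rcons say /= ac cy lexx /=.
      rewrite pairwise_rcons sord andbT.
      by apply: sub_all sab => p /and3P[].
    + by move=> p; rewrite mem_rcons in_cons => /predU1P[->|/sU].
    + rewrite big_rcons /=.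
      have := PhiW c y ac cy yb; lra.
  - exists s; split => //; first by rewrite /subdivision say.
    lra.
move=> [_ [s [sub sU]]] /le_trans; apply; apply/ltW/hd => //.
rewrite -lte_fin; apply: le_lt_trans Ud.
have := sum_measure_subdivision_le (@lebesgue_measure R) mU sub sU.
apply: le_trans; rewrite -sumEFin le_eqVlt; apply/orP; left; apply/eqP.
rewrite [RHS]big_seq [LHS]big_seq; apply: eq_bigr => p ps.
have /andP[/allP/(_ p ps) /and3P[_ p12 _] _] := sub.
rewrite [RHS](lebesgue_measure_itv `]p.1, p.2]) /= lte_fin; case: ltgtP p12 => // -> _.
by rewrite subrr.
Qed.

(** * Differentiability almost everywhere *)
Lemma ac_on_modulus (R : realType) (a b : R) (f : R -> R) :
  ac_on a b f -> forall e : R, 0 < e -> exists2 d : R, 0 < d &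
    forall x y, a <= x -> x <= y -> y <= b -> y - x < d -> `|f y - f x| < e.
Proof.
move=> acf e e0; have [d d0 hd] := acf e e0; exists d => // x y ax xy yb yxd.
have := hd [:: (x, y)]; rewrite !big_seq1 /=; apply => //.
by rewrite /subdivision /= ax xy yb.
Qed.

Lemma subdivision_path (R : realType) (x : R) (l : seq R) : path <%R x l ->
  subdivision x (last x l) (zip (x :: l) l) /\
  \sum_(p <- zip (x :: l) l) (p.2 - p.1) = last x l - x.
Proof.
elim: l x => [|y l IH] x; first by move=> _; split => //; rewrite big_nil subrr.
rewrite [path _ _ _]/= => /andP[xy /[dup] yl /IH].
have -> : zip (x :: y :: l) (y :: l) = (x, y) :: zip (y :: l) l by [].
move: (zip (y :: l) l) => z [/andP[zab zord] sumE] /=.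
have yl_ : y <= last y l.
  have /allP h := order_path_min lt_trans yl.
  by have := mem_last y l; rewrite in_cons => /predU1P[->|/h/ltW].
split; last by rewrite big_cons sumE /=; ring.
rewrite /subdivision /= lexx (ltW xy) yl_ zord andbT /=; apply/andP; split.
  by apply: sub_all zab => p /and3P[/(le_trans (ltW xy))-> -> ->].
by rewrite andbT; apply: sub_all zab => p /and3P[].
Qed.

Lemma subdivision_refine (R : realType) (a b : R) (t r s : seq (R * R)) p :
  subdivision a b (t ++ p :: s) -> subdivision p.1 p.2 r ->
  subdivision a b (t ++ r ++ s).
Proof.
move=> /andP[sab sord] /andP[rp rord]; apply/andP; split.
  move: sab; rewrite !all_cat /= => /and3P[-> /and3P[ap _ pb] ->].
  rewrite andbT /=; apply: sub_all rp => q /and3P[pq -> qp].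
  by rewrite (le_trans ap pq) (le_trans qp pb).
move: sord; rewrite !pairwise_cat /= !allrel_consr !allrel_catr.
move=> /and4P[/andP[tp ts] -> ps ->]; rewrite ts rord !andbT /=.
apply/andP; split.
  apply/allrelP => q1 q2 q1t q2r; apply: le_trans (allP tp q1 q1t) _.
  by have /and3P[] := allP rp q2 q2r.
apply/allrelP => q1 q2 q1r q2s; apply: le_trans (allP ps q2 q2s).
by have /and3P[] := allP rp q1 q1r.
Qed.

(** The total variation inherits the modulus of absolute continuity: refining
    each cell by a partition produces a family with the same total length. The
    cells are refined one after the other; t collects the cells already
    replaced, on which only the increments of f are counted. *)
Lemma ac_on_sum_total_variation (R : realType) (a b : R) (f : R -> R) :
  ac_on a b f -> forall e : R, 0 < e -> exists2 d : R, 0 < d &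
    forall s, subdivision a b s -> \sum_(p <- s) (p.2 - p.1) < d ->
      (\sum_(p <- s) total_variation p.1 p.2 f <= e%:E)%E.
Proof.
move=> acf e e0; have [d d0 hd] := acf e e0; exists d => //.
suff key s t : subdivision a b (t ++ s) ->
    \sum_(p <- t ++ s) (p.2 - p.1) < d ->
    (\sum_(p <- s) total_variation p.1 p.2 f +
      (\sum_(p <- t) `|f p.2 - f p.1|)%:E <= e%:E)%E.
  by move=> s sub sd; have := key s [::] sub sd; rewrite big_nil adde0.
elim: s t => [|p s IH] t.
  by rewrite cats0 big_nil add0e lee_fin => sub sd; apply/ltW/hd.
move=> sub sd.
have TV0 q : q \in t ++ p :: s -> (0 <= total_variation q.1 q.2 f)%E.
  move=> qs; apply: total_variation_ge0.
  by have /andP[/allP/(_ _ qs)/and3P[]] := sub.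
have TVs0 : (0 <= \sum_(q <- s) total_variation q.1 q.2 f)%E.
  rewrite big_seq; apply: sume_ge0 => q qs; apply: TV0.
  by rewrite mem_cat in_cons qs !orbT.
have step r : subdivision p.1 p.2 r -> \sum_(q <- r) (q.2 - q.1) = p.2 - p.1 ->
    (\sum_(q <- s) total_variation q.1 q.2 f +
      (\sum_(q <- t) `|f q.2 - f q.1| +
       \sum_(q <- r) `|f q.2 - f q.1|)%:E <= e%:E)%E.
  move=> subr sumr; rewrite -big_cat; apply: IH; rewrite -catA.
    exact: subdivision_refine sub subr.
  by move: sd; rewrite !big_cat big_cons /= sumr.
have /and3P[_ p12 _] : [&& a <= p.1, p.1 <= p.2 & p.2 <= b].
  by have /andP[/allP/(_ p) + _] := sub; rewrite mem_cat mem_head orbT; exact.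
have fins : (\sum_(q <- s) total_variation q.1 q.2 f)%E \is a fin_num.
  rewrite ge0_fin_numE //; apply: (@le_lt_trans _ _ e%:E); last exact: ltry.
  apply: le_trans (step [:: p] _ _); last by rewrite big_seq1.
    by rewrite leeDl // lee_fin addr_ge0 ?sumr_ge0.
  by rewrite /subdivision /= !lexx p12.
rewrite big_cons -addeA -(fineK fins) -EFinD addeC -leeBrDl //.
apply: ge_ereal_sup => _ [_ [l pl <-] <-].
have [pathl /eqP lastl] := pl.
have [subl suml] := subdivision_path pathl.
rewrite lastl in subl suml.
have := step _ subl suml; rewrite -[in X in X -> _](fineK fins) -EFinD !lee_fin.
have -> : \sum_(q <- zip (p.1 :: l) l) `|f q.2 - f q.1| = variation p.1 p.2 f l.
  rewrite (variation_zip _ pl).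
  elim: (l) (p.1) => [|y l' IHl] x /=; first by rewrite !big_nil.
  by rewrite !big_cons IHl.
lra.
Qed.

(** Each cell shorter than the modulus of f for 1 has variation at most 1, so the
    variation stays finite along [a, b]. *)
Lemma ac_on_bounded_variation (R : realType) (a b : R) (f : R -> R) :
  a <= b -> ac_on a b f -> bounded_variation a b f.
Proof.
move=> ab acf; apply/bounded_variationP => //.
rewrite ge0_fin_numE ?total_variation_ge0 //.
have [d d0 hd] := ac_on_sum_total_variation acf ltr01.
have : a <= b /\ (total_variation a b f < +oo)%E.
  apply: (@real_induction _ a b
    (fun x => a <= x /\ (total_variation a x f < +oo)%E)) => //.
    by rewrite total_variationxx ltry.
  move=> x _; exists d => // c y [ac cx xy yb] ycd [_ TVc].
  have cy := le_trans cx xy.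
  split; first exact: le_trans cy.
  rewrite (total_variationD f ac cy) lte_add_pinfty //.
  apply: le_lt_trans (ltry 1); have := hd [:: (c, y)]; rewrite !big_seq1.
  by apply => //; rewrite /subdivision /= ac cy yb.
by case.
Qed.

Lemma ac_onB (R : realType) (a b : R) (f g : R -> R) :
  ac_on a b f -> ac_on a b g -> ac_on a b (fun x => f x - g x).
Proof.
move=> acf acg e e0; have e20 : 0 < e / 2 by lra.
have [d1 d10 h1] := acf _ e20; have [d2 d20 h2] := acg _ e20.
exists (Num.min d1 d2); first by rewrite lt_min d10.
move=> s sub; rewrite lt_min => /andP[/(h1 s sub) s1 /(h2 s sub) s2].
apply: (@le_lt_trans _ _ (\sum_(p <- s) (`|f p.2 - f p.1| + `|g p.2 - g p.1|))).
  apply: ler_sum => p _; rewrite -[`|g p.2 - _|]normrN.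
  by apply: le_trans (ler_normD _ _); rewrite le_eqVlt; apply/orP; left;
     apply/eqP; congr `|_|; ring.
by rewrite big_split /=; lra.
Qed.

(** Jordan decomposition f = V - (V - f), with V the variation from a. *)
Lemma ac_on_monotone_decomposition (R : realType) (a b : R) (f : R -> R) :
  a <= b -> ac_on a b f -> exists u v : R -> R,
  [/\ {in `[a, b] &, nondecreasing_fun u}, {in `[a, b] &, nondecreasing_fun v},
      ac_on a b u, ac_on a b v & forall x, f x = u x - v x].
Proof.
move=> ab acf.
pose V x := fine (total_variation a x f).
have bvf := ac_on_bounded_variation ab acf.
have TVfin x y : a <= x -> x <= y -> y <= b -> total_variation x y f \is a fin_num.
  move=> ax xy yb; apply/bounded_variationP => //.
  apply: (@bounded_variationr _ a) => //.
  apply: (@bounded_variationl _ a y b) => //; exact: le_trans xy.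
have VB x y : a <= x -> x <= y -> y <= b ->
    V y - V x = fine (total_variation x y f).
  move=> ax xy yb; rewrite /V (total_variationD f ax xy) fineD ?TVfin //.
    by rewrite addrAC subrr add0r.
  exact: le_trans yb.
have fV x y : a <= x -> x <= y -> y <= b -> `|f y - f x| <= V y - V x.
  move=> ax xy yb; rewrite VB // -lee_fin fineK ?TVfin //.
  exact: total_variation_ge.
have acV : ac_on a b V.
  move=> e e0; have [d d0 hd] := ac_on_sum_total_variation acf (divr_gt0 e0 (ltr0n R 2)).
  exists d => // s sub sd; apply: (@le_lt_trans _ _ (e / 2)); last lra.
  rewrite -lee_fin; apply: le_trans (hd s sub sd).
  rewrite -sumEFin big_seq [leRHS]big_seq; apply: lee_sum => p ps.
  have /andP[/allP/(_ p ps)/and3P[ap p12 pb] _] := sub.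
  rewrite VB // ger0_norm ?fine_ge0 ?total_variation_ge0 //.
  by rewrite fineK ?TVfin.
exists V, (fun x => V x - f x); split => //.
- move=> x y; rewrite !in_itv /= => /andP[ax _] /andP[_ yb] xy.
  by have := fV x y ax xy yb; have := normr_ge0 (f y - f x); lra.
- move=> x y; rewrite !in_itv /= => /andP[ax _] /andP[_ yb] xy.
  by have := fV x y ax xy yb; have := ler_norm (f y - f x); lra.
- exact: ac_onB.
- by move=> x; ring.
Qed.

(** A nondecreasing absolutely continuous u is, up to a constant, the integral of
    the density of its Stieltjes measure, hence differentiable almost
    everywhere. *)
Section nondecreasing_ac.
Context (R : realType) (a b : R) (u : R -> R).
Hypothesis ab : a < b.
Hypothesis ndu : {in `[a, b] &, nondecreasing_fun u}.
Hypothesis acu : ac_on a b u.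

(* Constant outside [a, b], U is monotone and right-continuous on the whole line,
   as the construction of the Stieltjes measure requires. *)
Let clamp x := Num.max a (Num.min b x).

Let clamp_itv x : a <= clamp x <= b.
Proof. by rewrite /clamp le_max lexx /= ge_max (ltW ab) ge_min lexx. Qed.

Let clampE x : a <= x -> x <= b -> clamp x = x.
Proof. by move=> ax xb; rewrite /clamp (min_idPr xb) (max_idPr ax). Qed.

Let clamp_le x y : x <= y -> clamp x <= clamp y.
Proof.
move=> xy; rewrite /clamp /Num.max /Num.min.
by repeat case: ifPn; rewrite -?leNgt => *; lra.
Qed.

Let clampB x y : x <= y -> clamp y - clamp x <= y - x.
Proof.
move=> xy; rewrite /clamp /Num.max /Num.min.
by repeat case: ifPn; rewrite -?leNgt => *; have := ab; lra.
Qed.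

Let U x := u (clamp x).

Let ndU : nondecreasing U.
Proof. by move=> x y xy; apply: ndu; rewrite ?in_itv /= ?clamp_itv ?clamp_le. Qed.

Let rcU : forall x, U @ at_right x --> U x.
Proof.
move=> x; apply/cvgrPdist_lt => e e0; have [d d0 hd] := ac_on_modulus acu e0.
near=> y; rewrite distrC.
have xy : x <= y by near: y; exact: nbhs_right_ge.
have /andP[ax xb] := clamp_itv x; have /andP[ay yb] := clamp_itv y.
apply: hd => //; first exact: clamp_le.
apply: le_lt_trans (clampB xy) _; rewrite ltrBlDl.
by near: y; apply: nbhs_right_lt; rewrite ltrDl.
Unshelve. all: by end_near. Qed.

Let Uc : cumulative R R := HB.pack U (isCumulative.Build R _ R U ndU rcU).

Let nu : {measure set (measurableTypeR R) -> \bar R} :=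
  lebesgue_stieltjes_measure Uc.

Let nu_itv x y : a <= x -> x <= y -> y <= b ->
  nu `]x, y]%classic = (u y - u x)%:E.
Proof.
move=> ax xy yb; rewrite /nu /= /lebesgue_stieltjes_measure /measure_extension.
rewrite measurable_mu_extE /=; last exact: is_ocitv.
rewrite wlength_itv_bnd // /U !clampE //; first exact: le_trans yb.
exact: le_trans xy.
Qed.

Let mitv x y : measurable (`]x, y]%classic : set (measurableTypeR R)).
Proof. exact: measurable_itv. Qed.

Let nuD : (nu `]a, b]%classic < +oo)%E.
Proof. by rewrite nu_itv ?lexx ?(ltW ab) ?ltry. Qed.

(* The Radon-Nikodym theorem is applied to a finite measure. *)
Let nu' : {finite_measure set (measurableTypeR R) -> \bar R} := mfrestr (mitv a b) nuD.

Let nu'E A : nu' A = nu (A `&` `]a, b]).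
Proof. by []. Qed.

(* Inner regularity on open sets, by the closed sets of the points that are at
   distance at least 1 / (n + 1) from the complement. The positive distance is
   what separates the cells meeting K from those centred outside V. *)
Let open_nu (V : set R) e : open V -> 0 < e ->
  (forall K : set R, K `<=` V -> measurable K ->
     (exists2 r : R, 0 < r & forall x y, K x -> ~ V y -> r <= `|y - x|) ->
     (nu' K <= e%:E)%E) -> (nu' V <= e%:E)%E.
Proof.
move=> oV e0 hK.
pose K n := [set x | forall y, ~ V y -> n.+1%:R^-1 <= `|y - x|].
have cK n : closed (K n).
  rewrite (_ : K n = \bigcap_(y in ~` V) [set x | n.+1%:R^-1 <= `|y - x|]) //.
  apply: closed_bigI => y _.
  apply: (@closed_comp _ _ (fun x => `|y - x|) [set z | n.+1%:R^-1 <= z]).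
    by move=> x _; apply: cvg_norm; apply: cvgB; [exact: cvg_cst|exact: cvg_id].
  exact: closed_ge.
have mK n : measurable (K n) by exact: closed_measurable.
have KV : V = \bigcup_n K n.
  apply/seteqP; split => x.
    move=> Vx; have /nbhs_ballP[r r0 rV] : nbhs x V by exact: open_nbhs_nbhs.
    have [n nr] : exists n : nat, n.+1%:R^-1 < r.
      have /= := near_infty_natSinv_lt (PosNum r0) => -[n _ hn].
      by exists n; apply: hn => /=.
    exists n => // y Vy; rewrite leNgt; apply/negP => yx; apply: Vy.
    by apply: rV; rewrite /ball /= distrC (lt_trans yx).
  move=> [n _ Kx]; have [//|Vx] := pselect (V x).
  have := Kx x Vx; rewrite subrr normr0 leNgt.
  by rewrite invr_gt0 ltr0n.
have : (nu' \o K) n @[n --> \oo] --> nu' (\bigcup_n K n).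
  apply: nondecreasing_cvg_mu => //; first by rewrite -KV; exact: open_measurable.
  move=> m n mn; apply/subsetPset => x Kx y Vy; apply: le_trans (Kx y Vy).
  by rewrite lef_pV2 ?posrE ?ltr0n // ler_nat.
rewrite -KV => cK'; apply: (cvge_le _ cK').
apply: nearW => n; apply: hK => //; first by rewrite KV => x Kx; exists n.
exists n.+1%:R^-1; first by rewrite invr_gt0.
by move=> x y Kx Vy; exact: Kx.
Qed.

(* A null set lies in an open V of small measure. Inside V, a closed K at positive
   distance from the complement of V is met only by short cells contained in V,
   so its measure is bounded by the variation of u over such cells. *)
Let nu'_dominated : nu' `<< @lebesgue_measure R.
Proof.
apply/null_content_dominatesP => A mA A0.
apply/eqP; rewrite eq_le measure_ge0 andbT; apply/lee_addgt0Pr => e e0.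
rewrite add0e.
have [d d0 hd] := ac_on_control (ltW ab) acu e0.
have [|V [oV AV Vd]] := @lebesgue_regularity_outer R A _ mA _ d0.
  by rewrite A0 ltry.
have mV : measurable V by exact: open_measurable.
have muV : (@lebesgue_measure R V < d%:E)%E.
  rewrite -(setDUK AV) measureU //; last by rewrite setDIK.
    by rewrite A0 add0e.
  exact: measurableD.
apply: (@le_trans _ _ (nu' V)); first by apply: le_measure; rewrite ?inE.
apply: open_nu => // K KV mK [r r0 hr].
pose Phi x := fine (nu (K `&` `]a, x])).
have PhiB x y : a <= x -> x <= y -> y <= b ->
    (Phi y - Phi x)%:E = nu (K `&` `]x, y]).
  move=> ax xy yb.
  have fin z w : a <= z -> z <= w -> w <= b -> nu (K `&` `]z, w]) \is a fin_num.
    move=> az zw wb; rewrite ge0_fin_numE //.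
    apply: (@le_lt_trans _ _ (nu `]z, w]%classic)); last by rewrite nu_itv // ltry.
    apply: le_measure; rewrite ?inE; [exact: measurableI|exact: mitv|].
    exact: subIsetr.
  rewrite EFinB !fineK ?fin //; last 2 first.
  - exact: le_trans yb.
  - exact: le_trans xy.
  rewrite (@itv_bndbnd_setU _ _ (BRight a) (BRight x) (BRight y)) //.
  rewrite setIUr measureU; last 3 first.
  - exact: measurableI.
  - exact: measurableI.
  - rewrite setIACA setIid; apply/seteqP; split => // z [_ []] /=.
    by rewrite !in_itv /= => /andP[_ zx] /andP[/lt_geF]; rewrite zx.
  by rewrite addeAC subee ?add0e ?fin // (le_trans xy).
have <- : (Phi b - Phi a)%:E = nu' K by rewrite PhiB ?lexx ?(ltW ab).
rewrite lee_fin; apply: (hd V mV muV Phi).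
  move=> x y ax xy yb; apply: le_trans (ler_norm _).
  rewrite -lee_fin PhiB // -nu_itv //.
  apply: le_measure; rewrite ?inE; [exact: measurableI|exact: mitv|].
  exact: subIsetr.
move=> x /andP[ax xb]; have [Vx|Vx] := pselect (V x).
  have /nbhs_ballP[r' r'0 rV] : nbhs x V by exact: open_nbhs_nbhs.
  exists r' => // y z [ay yx xz zb] zyr; left => t /=.
  rewrite in_itv /= => /andP[yt tz]; apply: rV; rewrite /ball /=.
  by rewrite ltr_norml; apply/andP; split; lra.
exists r => // y z [ay yx xz zb] zyr; right.
rewrite -subr_le0 -lee_fin PhiB //; last exact: le_trans xz.
rewrite (_ : _ `&` _ = set0) ?measure0 //.
apply/seteqP; split => // t [Kt]; rewrite /= in_itv /= => /andP[yt tz].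
have := hr _ _ Kt Vx; rewrite leNgt => /negP; apply.
by rewrite ltr_norml; apply/andP; split; lra.
Qed.

Lemma nondecreasing_ac_derivable_ae :
  {ae @lebesgue_measure R, forall x, a < x -> x < b -> derivable u x 1}.
Proof.
have [g [g0 gfin intg gE]] := radon_nikodym_sigma_finite nu'_dominated.
pose h := fine \o g.
have hg : EFin \o h = g by apply/funext => x /=; rewrite fineK.
rewrite -hg in intg gE.
have inth y : (@lebesgue_measure R).-integrable `]a, y] (EFin \o h).
  by apply: integrableS intg => //; exact: measurable_itv.
have loch : locally_integrable [set: R] h.
  by apply: open_integrable_locally => //; exact: openT.
have := FTC1 inth loch; apply: filterS => x hx ax xb.
have [dF _] := hx ax.
pose F y := \int[lebesgue_measure]_(t in `]a, y]) h t.
have dF' : derivable (cst (u a) \+ F) x 1 by apply: derivableD.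
apply: near_eq_derivable dF'.
near=> y.
have ay : a <= y by apply/ltW; near: y; exact: lt_nbhsr.
have yb : y <= b by apply/ltW; near: y; exact: lt_nbhsl.
have ny : nu' `]a, y]%classic = (u y - u a)%:E.
  rewrite nu'E -nu_itv //; congr (nu _); apply: setIidl => z /=.
  by rewrite !in_itv /= => /andP[-> zy]; exact: le_trans yb.
have := gE _ (measurable_itv `]a, y]).
rewrite ny /= /F /Rintegral => <- /=; ring.
Unshelve. all: by end_near. Qed.
End nondecreasing_ac.

(** Jordan decomposition reduces to the monotone case. *)
Lemma ac_on_derivable_ae (R : realType) (a b : R) (f : R -> R) :
  a < b -> ac_on a b f ->
  {ae @lebesgue_measure R, forall x, a < x -> x < b -> derivable f x 1}.
Proof.
move=> ab acf.
have [u [v [ndu ndv acu acv fE]]] := ac_on_monotone_decomposition (ltW ab) acf.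
have -> : f = u \- v by apply/funext.
have := nondecreasing_ac_derivable_ae ab ndv acv.
have := nondecreasing_ac_derivable_ae ab ndu acu.
by apply: filterS2 => x hu hv ax xb; apply: derivableB; [exact: hu|exact: hv].
Qed.

(** The cells around x may contain it in their interior: the increments on both
    sides of x add up. *)
Lemma derivable_slope_lt (R : realType) (f : R -> R) (x e : R) :
  derivable f x 1 -> derive1 f x < e -> exists2 r, 0 < r &
    forall y z, [/\ y <= x, x <= z & z - y < r] -> f z - f y <= e * (z - y).
Proof.
move=> df fe.
have : \forall h \near 0^', h^-1 *: (f (h *: 1 + x) - f x) < e.
  have [l hl] := (cvg_ex _).1 df; move/cvg_lim: (hl) => /(_ (@Rhausdorff R)) limE.
  apply: (cvgr_lt _ hl); rewrite -limE; move: fe; rewrite derive1E; exact.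
move=> /nbhs_ballP[r r0 hr]; exists r => // y z [yx xz zyr].
have up : f z - f x <= e * (z - x).
  move: xz; rewrite le_eqVlt => /predU1P[->|xz]; first by rewrite !subrr mulr0.
  have zx0 : 0 < z - x by lra.
  have := hr (z - x); rewrite /ball /= sub0r normrN gtr0_norm //.
  rewrite gt_eqF // => /(_ _ isT); rewrite scaler1 subrK => h.
  by rewrite mulrC -ler_pdivrMl //; apply/ltW/h; lra.
have dn : f x - f y <= e * (x - y).
  move: yx; rewrite le_eqVlt => /predU1P[->|yx]; first by rewrite !subrr mulr0.
  have zx0 : y - x < 0 by lra.
  have := hr (y - x); rewrite /ball /= sub0r normrN ltr0_norm //.
  rewrite lt_eqF // => /(_ _ isT); rewrite scaler1 subrK => h.
  have xy0 : 0 < x - y by lra.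
  rewrite mulrC -ler_pdivrMl //; apply/ltW.
  rewrite -(opprB y x) -(opprB (f y)) invrN mulrNN; apply: h; lra.
lra.
Qed.

(** The points where the hypothesis fails, together with the two endpoints, are
    covered by an open set of small measure, and around all the others W grows
    by less than a small slope. Absolute continuity is what excludes functions
    such as the Cantor staircase. *)
Lemma ac_on_nonincreasing (R : realType) (a b : R) (W : R -> R) :
  a <= b -> ac_on a b W ->
  {ae @lebesgue_measure R, forall x, a < x -> x < b ->
     derivable W x 1 /\ derive1 W x <= 0} ->
  W b <= W a.
Proof.
move=> ab acW [N0 [mN0 N00 hN0]].
pose N : set R := N0 `|` ([set a] `|` [set b]).
have mN : measurable N.
  by apply: measurableU => //; apply: measurableU; exact: measurable_set1.
have N0E : @lebesgue_measure R N = 0%E.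
  apply/eqP; rewrite eq_le measure_ge0 andbT.
  apply: le_trans (measureU2 _ _ _) _ => //.
    by apply: measurableU; exact: measurable_set1.
  rewrite [X in (X + _)%E](_ : _ = 0%E) ?add0e; last exact: N00.
  apply: le_trans (measureU2 _ _ _) _; try exact: measurable_set1.
  rewrite [X in (X + _)%E](lebesgue_measure_set1 a).
  by rewrite [X in (_ + X)%E](lebesgue_measure_set1 b) adde0.
apply/ler_addgt0Pr => e e0.
(* Half of e pays for the cells inside V; the slope e1 spends at most the other
   half over [a, b], and b - a + 1 is positive even if a = b. *)
pose e1 := e / 2 / (b - a + 1).
have e10 : 0 < e1 by rewrite !divr_gt0 //; lra.
have e20 : 0 < e / 2 by lra.
have [d d0 hd] := ac_on_control ab acW e20.
have [|V [oV NV Vd]] := @lebesgue_regularity_outer R N _ mN _ d0.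
  by apply: (@le_lt_trans _ _ 0%E) => //; rewrite le_eqVlt; apply/orP; left; apply/eqP.
have mV : measurable V by exact: open_measurable.
have muV : (@lebesgue_measure R V < d%:E)%E.
  rewrite -(setDUK NV) measureU //; last by rewrite setDIK.
    by rewrite [X in (X + _)%E](_ : _ = 0%E) ?add0e.
  exact: measurableD.
have := hd V mV muV (fun x => W x - e1 * x).
have : e1 * (b - a) <= e / 2.
  by rewrite /e1 -mulrA ler_piMr ?(ltW e20) // ler_pdivrMl; lra.
suff key : forall x, a <= x <= b -> exists2 r : R, 0 < r &
    forall y z, [/\ a <= y, y <= x, x <= z & z <= b] -> z - y < r ->
    `]y, z] `<=` V \/ W z - e1 * z <= W y - e1 * y.
  move=> be /(_ _ key) h.
  suff : W b - e1 * b - (W a - e1 * a) <= e / 2 by lra.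
  apply: h => x y ax xy yb.
  have := ler_norm (W y - W x).
  have : e1 * x <= e1 * y by rewrite ler_pM2l.
  lra.
move=> x /andP[ax xb]; have [Vx|Vx] := pselect (V x).
  have /nbhs_ballP[r r0 rV] : nbhs x V by exact: open_nbhs_nbhs.
  exists r => // y z [ay yx xz zb] zyr; left => t /=.
  rewrite in_itv /= => /andP[yt tz]; apply: rV; rewrite /ball /=.
  by rewrite ltr_norml; apply/andP; split; lra.
have xN : ~ N x by move=> /NV.
have ax' : a < x.
  rewrite lt_neqAle ax andbT; apply/eqP => xE.
  by apply: xN; right; left; rewrite /= xE.
have xb' : x < b.
  rewrite lt_neqAle xb andbT; apply/eqP => xE.
  by apply: xN; right; right.
have [dW W0] : derivable W x 1 /\ derive1 W x <= 0.
  apply: contrapT => h; apply: xN; left; apply: hN0 => /=.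
  by move=> /(_ ax' xb').
have [r r0 hr] := derivable_slope_lt dW (le_lt_trans W0 e10).
exists r => // y z [ay yx xz zb] zyr; right.
have := hr y z; rewrite mulrBr => h; suff : W z - W y <= e1 * z - e1 * y by lra.
by apply: h.
Qed.

(** * Indefinite Lebesgue integrals *)
Section integral_ae_eq.
Context d (T : measurableType d) (R : realType).
Variable mu : {measure set T -> \bar R}.
Import HBNNSimple.

Let nnintegral (f : T -> \bar R) := ereal_sup [set sintegral mu h |
  h in [set h : {nnsfun T >-> R} | forall x, (h x)%:E <= f x]%E].

Let nnintegral_ae_le (f g : T -> \bar R) (N : set T) :
  measurable N -> mu N = 0%E -> (forall x, 0 <= g x)%E ->
  (forall x, ~ N x -> f x = g x) -> (nnintegral f <= nnintegral g)%E.
Proof.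
move=> mN N0 g0 fg; apply: ge_ereal_sup => _ [h hf <-].
have mNC : measurable (~` N) by exact: measurableC.
have -> : sintegral mu h = sintegral mu (proj_nnsfun h mNC).
  rewrite -integralT_nnsfun (ge0_negligible_integral mN) //.
  - by rewrite setTD integral_nnsfun // (mrestrict _ mNC).
  - by apply/measurable_EFinP.
  - by move=> x _; rewrite lee_fin; exact: fun_ge0.
apply: ereal_sup_ubound; exists (proj_nnsfun h mNC) => // x.
rewrite /= mindicE; have [xN|xN] := boolP (x \in ~` N).
  by rewrite mulr1 -fg //; exact: set_mem.
by rewrite mulr0.
Qed.

(** The integral is a supremum over the simple functions below the integrand, and a
    simple function does not change its integral when it is set to 0 on a null
    set. This gives the invariance under almost everywhere equality without
    measurability of either integrand. *)
Lemma integral_ae_eq_nonmeasurable (D : set T) (f g : T -> \bar R) :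
  {ae mu, forall x, D x -> f x = g x} ->
  (\int[mu]_(x in D) f x = \int[mu]_(x in D) g x)%E.
Proof.
move=> [N [mN N0 hN]].
have fgN x : ~ N x -> (f \_ D) x = (g \_ D) x.
  move=> Nx; rewrite !patchE; case: ifPn => // xD.
  by apply: contrapT => h; apply/Nx/hN => /= /(_ (set_mem xD)).
rewrite /integral; congr (_ - _)%E; apply/eqP; rewrite eq_le.
  by apply/andP; split; apply: (nnintegral_ae_le mN N0) => // x /fgN;
     rewrite !funeposE => ->.
by apply/andP; split; apply: (nnintegral_ae_le mN N0) => // x /fgN;
   rewrite !funenegE => ->.
Qed.

End integral_ae_eq.

Section indefinite_integral.
Context (R : realType).
Local Notation mu := (@lebesgue_measure R).

Let mitv (x y : R) : measurable (`]x, y]%classic : set (measurableTypeR R)).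
Proof. exact: measurable_itv. Qed.

(* A is the union of the cells. Knowing that each of its points lies beyond the
   left end of some cell is enough to see that A is disjoint from any cell
   preceding s. *)
Let subdivision_union (g : R -> R) (a b : R) s : mu.-integrable setT (EFin \o g) ->
  subdivision a b s -> exists A : set (measurableTypeR R),
  [/\ measurable A, forall x, A x -> exists2 p, p \in s & p.1 < x,
      (mu A <= (\sum_(p <- s) (p.2 - p.1))%:E)%E &
      \sum_(p <- s) \int[mu]_(x in `]p.1, p.2]) g x = \int[mu]_(x in A) g x].
Proof.
move=> ig; elim: s => [|p s IH].
  by move=> _; exists set0; split => //; rewrite big_nil ?measure0 ?Rintegral_set0.
rewrite /subdivision /= => /andP[/andP[/and3P[ap p12 pb] sab] /andP[ps sord]].
have [|A [mA As muA intA]] := IH; first by rewrite /subdivision sab.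
have disj : [disjoint `]p.1, p.2]%classic & A]%classic.
  apply/disj_setPRL => x /As[q qs qx] /=; rewrite in_itv /= => /andP[_ xp].
  by have := allP ps q qs; rewrite leNgt (lt_le_trans qx xp).
exists (`]p.1, p.2]%classic `|` A); split.
- exact: measurableU.
- move=> x [|/As[q qs qx]]; last by exists q => //; rewrite in_cons qs orbT.
  by rewrite /= in_itv /= => /andP[px _]; exists p; rewrite ?mem_head.
- apply: le_trans (measureU2 _ _ _) _ => //.
  rewrite big_cons EFinD; apply: leeD => //.
  rewrite [leLHS](lebesgue_measure_itv `]p.1, p.2]) /= lte_fin.
  by case: ifPn => // _; rewrite lee_fin subr_ge0.
- rewrite big_cons intA Rintegral_setU //.
  apply: integrableS ig => //; exact: measurableU.
Qed.

Variables (a b : R) (h : R -> R).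
Hypothesis inth : mu.-integrable `[a, b] (EFin \o h).

Let g := h \_ `[a, b].
Let intg : mu.-integrable setT (EFin \o g).
Proof.
by rewrite /g -restrict_EFin -integrable_mkcond.
Qed.

Let H x := \int[mu]_(t in `[a, x]) h t.

Lemma indefinite_integralB x y : a <= x -> x <= y -> y <= b ->
  \int[mu]_(t in `[a, y]) h t - \int[mu]_(t in `[a, x]) h t =
  \int[mu]_(t in `]x, y]) h t.
Proof.
move=> ax xy yb; rewrite Rintegral_itvB //.
apply: integrableS inth; try exact: measurable_itv.
by apply: subset_itvl; rewrite bnd_simp.
Qed.

(** Absolute continuity of the measure with density |h|, applied to the union of the
    cells. *)
Lemma indefinite_integral_ac : ac_on a b (fun x => \int[mu]_(t in `[a, x]) h t).
Proof.
move=> e e0.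
have intng : mu.-integrable setT (EFin \o (fun x => `|g x|)).
  by have := integrable_norm intg.
have [d [d0 hd]] := integral_normr_continuous intg e0.
exists d => // s sub sd.
have [A [mA _ muA intA]] := subdivision_union intng sub.
apply: le_lt_trans (hd A mA (le_lt_trans muA _)); last by rewrite lte_fin.
rewrite -intA big_seq [leRHS]big_seq; apply: ler_sum => p ps.
have /andP[/allP/(_ p ps)/and3P[ap p12 pb] _] := sub.
rewrite indefinite_integralB //.
have sub_ : `]p.1, p.2] `<=` `[a, b].
  move=> x /=; rewrite !in_itv /= => /andP[px xp].
  by rewrite (le_trans ap (ltW px)) (le_trans xp).
apply: le_trans (le_normr_Rintegral _ _) _ => //.
  by apply: integrableS inth => //; exact: measurable_itv.
rewrite le_eqVlt; apply/orP; left; apply/eqP; apply: eq_Rintegral => x xp.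
by rewrite /g patchE mem_set //; apply: sub_; exact: set_mem.
Qed.

(** Lebesgue's differentiation theorem, for h extended by 0 outside [a, b]. *)
Lemma indefinite_integral_is_derive_ae :
  {ae mu, forall x, a < x -> x < b ->
    is_derive x 1 (fun x => \int[mu]_(t in `[a, x]) h t) (h x)}.
Proof.
have locg : locally_integrable [set: R] g.
  by apply: open_integrable_locally => //; exact: openT.
have intgy y : mu.-integrable `[a, y] (EFin \o g).
  by apply: integrableS intg => //; exact: measurable_itv.
have := FTC1 intgy locg; apply: filterS => x hx ax xb.
have [dF FE] := hx ax.
have -> : h x = g x.
  by rewrite /g patchE mem_set //= in_itv /= !ltW.
apply: near_eq_is_derive; last first.
  by apply: DeriveDef dF _; rewrite -derive1E.
near=> y; apply: eq_Rintegral => t; rewrite inE /= in_itv /= => /andP[a_t ty].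
rewrite /g patchE mem_set //= in_itv /= a_t (le_trans ty) //.
by apply/ltW; near: y; exact: lt_nbhsl.
Unshelve. all: by end_near. Qed.

End indefinite_integral.

(** * Stability of absolute continuity *)
Lemma ac_on_bounded (R : realType) (a b : R) (f : R -> R) :
  a <= b -> ac_on a b f ->
  exists2 M : R, 0 < M & forall x, a <= x -> x <= b -> `|f x| <= M.
Proof.
move=> ab acf; have bvf := ac_on_bounded_variation ab acf.
have TVfin := (bounded_variationP f ab).1 bvf.
exists (`|f a| + fine (total_variation a b f) + 1).
  by rewrite ltr_pwDr // addr_ge0 // fine_ge0 // total_variation_ge0.
move=> x ax xb.
suff : `|f x - f a| <= fine (total_variation a b f).
  by have := ler_normD (f x - f a) (f a); rewrite subrK; lra.
rewrite -lee_fin fineK //; apply: le_trans (total_variation_ge f ax) _.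
by rewrite (total_variationD f ax xb) leeDl // total_variation_ge0.
Qed.

Lemma ac_on_within_continuous (R : realType) (a b : R) (f : R -> R) :
  ac_on a b f -> {within `[a, b], continuous f}.
Proof.
move=> acf; apply/subspace_continuousP => x /=; rewrite in_itv /= => /andP[ax xb].
apply/cvgrPdist_lt => e e0; have [d d0 hd] := ac_on_modulus acf e0.
apply/nbhs_ballP; exists d => //= y; rewrite /ball /= in_itv /= => xyd /andP[ay yb].
have [xy|/ltW yx] := leP x y.
  by rewrite distrC; apply: hd => //; move: xyd; rewrite ltr_norml => /andP[]; lra.
by apply: hd => //; move: xyd; rewrite ltr_norml => /andP[]; lra.
Qed.

Lemma ac_on_sub (R : realType) (a b a' b' : R) (f : R -> R) :
  a <= a' -> b' <= b -> ac_on a b f -> ac_on a' b' f.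
Proof.
move=> aa bb acf e e0; have [d d0 hd] := acf e e0; exists d => // s /andP[sab sord].
apply: hd; rewrite /subdivision sord andbT; apply: sub_all sab.
by move=> p /and3P[/(le_trans aa)-> -> /le_trans->].
Qed.

(** Sums, products, inverses and functions with bounded derivative are handled
    below by this comparison of increments. *)
Lemma ac_on_dominated (R : realType) (a b C : R) (f g h : R -> R) :
  ac_on a b f -> ac_on a b g ->
  (forall x y, a <= x -> x <= y -> y <= b ->
     `|h y - h x| <= C * (`|f y - f x| + `|g y - g x|)) ->
  ac_on a b h.
Proof.
move=> acf acg hC e e0.
pose C1 := Num.max C 1.
have C10 : 0 < C1 by rewrite lt_max ltr01 orbT.
have e20 : 0 < e / C1 / 2 by rewrite !divr_gt0.
have [d1 d10 h1] := acf _ e20; have [d2 d20 h2] := acg _ e20.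
exists (Num.min d1 d2); first by rewrite lt_min d10.
move=> s sub; rewrite lt_min => /andP[/(h1 s sub) s1 /(h2 s sub) s2].
apply: (@le_lt_trans _ _
  (\sum_(p <- s) C1 * (`|f p.2 - f p.1| + `|g p.2 - g p.1|))).
  rewrite big_seq [leRHS]big_seq; apply: ler_sum => p ps.
  have /andP[/allP/(_ p ps)/and3P[ap p12 pb] _] := sub.
  by apply: le_trans (hC _ _ ap p12 pb) _; rewrite ler_wpM2r ?addr_ge0 // le_max lexx.
rewrite -mulr_sumr big_split /= -ltr_pdivlMl // mulrC; lra.
Qed.

Lemma ac_onD (R : realType) (a b : R) (f g : R -> R) :
  ac_on a b f -> ac_on a b g -> ac_on a b (fun x => f x + g x).
Proof.
move=> acf acg; apply: (ac_on_dominated (C := 1) acf acg) => x y _ _ _.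
rewrite mul1r; apply: le_trans (ler_normD _ _).
by rewrite le_eqVlt; apply/orP; left; apply/eqP; congr `|_|; ring.
Qed.

Lemma ac_onM (R : realType) (a b : R) (f g : R -> R) : a <= b ->
  ac_on a b f -> ac_on a b g -> ac_on a b (fun x => f x * g x).
Proof.
move=> ab acf acg.
have [M M0 fM] := ac_on_bounded ab acf; have [N N0 gN] := ac_on_bounded ab acg.
apply: (ac_on_dominated (C := M + N) acf acg) => x y ax xy yb.
have -> : f y * g y - f x * g x = f y * (g y - g x) + g x * (f y - f x) by ring.
apply: le_trans (ler_normD _ _) _; rewrite !normrM.
have := ler_wpM2r (normr_ge0 (g y - g x)) (fM y (le_trans ax xy) yb).
have := ler_wpM2r (normr_ge0 (f y - f x)) (gN x ax (le_trans xy yb)).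
have := mulr_ge0 (ltW M0) (normr_ge0 (f y - f x)).
have := mulr_ge0 (ltW N0) (normr_ge0 (g y - g x)).
rewrite mulrDl !mulrDr; lra.
Qed.

Lemma ac_onV (R : realType) (a b : R) (f : R -> R) : a <= b ->
  ac_on a b f -> (forall x, a <= x -> x <= b -> f x != 0) ->
  ac_on a b (fun x => (f x)^-1).
Proof.
move=> ab acf f0.
have acN : ac_on a b (fun x => `|f x|).
  apply: (ac_on_dominated (C := 1) acf acf) => x y _ _ _.
  rewrite mul1r; apply: le_trans (ler_dist_dist _ _) _.
  by rewrite lerDl.
have [c cab cmin] := EVT_min ab (ac_on_within_continuous acN).
move: cab; rewrite in_itv /= => /andP[ac cb].
have m0 : 0 < `|f c| by rewrite normr_gt0 f0.
apply: (ac_on_dominated (C := (`|f c| ^+ 2)^-1) acf acf) => x y ax xy yb.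
have ay := le_trans ax xy; have xb := le_trans xy yb.
have fx0 := f0 x ax xb; have fy0 := f0 y ay yb.
have -> : (f y)^-1 - (f x)^-1 = - ((f y - f x) / (f x * f y)) by field; apply/andP.
rewrite normrN normrM normfV normrM mulrC.
apply: ler_pM; rewrite ?invr_ge0 ?mulr_ge0 //.
  rewrite lef_pV2 ?posrE ?exprn_gt0 // ?mulr_gt0 ?normr_gt0 //.
  by rewrite expr2; apply: ler_pM => //; apply: cmin; rewrite in_itv /= ?ax ?ay.
by rewrite lerDl.
Qed.

Lemma is_derive_continuous (R : realType) (f : R -> R) (x df : R) :
  is_derive x 1 f df -> {for x, continuous f}.
Proof. by move=> [dfx _]; apply: differentiable_continuous; apply/derivable1_diffP. Qed.

Lemma within_continuous_for (R : realType) (A : set R) (f : R -> R) :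
  (forall x, A x -> {for x, continuous f}) -> {within A, continuous f}.
Proof.
move=> cf; apply/subspace_continuousP => x Ax.
by apply: cvg_within_filter; exact: cf.
Qed.

Lemma ac_on_bounded_derive (R : realType) (a b M : R) (f df : R -> R) :
  (forall x, a <= x -> x <= b -> is_derive x 1 f (df x)) ->
  (forall x, a <= x -> x <= b -> `|df x| <= M) -> ac_on a b f.
Proof.
move=> fdf dfM.
have acid : ac_on a b (fun x : R => x).
  move=> e e0; exists e => // s /andP[/allP sab _]; apply: le_lt_trans.
  rewrite big_seq [leRHS]big_seq; apply: ler_sum => p /sab /and3P[_ p12 _].
  by rewrite ger0_norm ?subr_ge0.
apply: (ac_on_dominated (C := M) acid acid) => x y ax xy yb.
have [||c /[!in_itv] /= /andP[xc cy] ->] := @MVT_segment _ f df x y xy.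
- by move=> z; rewrite in_itv /= => /andP[xz zy]; apply: fdf; lra.
- apply: within_continuous_for => z /=; rewrite in_itv /= => /andP[xz zy].
  by apply: (@is_derive_continuous _ _ _ (df z)); apply: fdf; lra.
rewrite normrM; have h : `|df c| <= M by apply: dfM; lra.
apply: ler_pM => //; by rewrite lerDl.
Qed.

Lemma is_derive1D (R : realType) (f g : R -> R) (x df dg : R) :
  is_derive x 1 f df -> is_derive x 1 g dg ->
  is_derive x 1 (fun t => f t + g t) (df + dg).
Proof. by move=> hf hg; exact: is_deriveD. Qed.

Lemma is_derive1M (R : realType) (f g : R -> R) (x df dg : R) :
  is_derive x 1 f df -> is_derive x 1 g dg ->
  is_derive x 1 (fun t => f t * g t) (f x * dg + g x * df).
Proof. by move=> hf hg; exact: is_deriveM. Qed.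

Lemma is_derive1V (R : realType) (f : R -> R) (x df : R) : f x != 0 ->
  is_derive x 1 f df -> is_derive x 1 (fun t => (f t)^-1) (- (f x) ^- 2 * df).
Proof. by move=> fx hf; exact: is_deriveV. Qed.

(** * The Riccati equation of a nonprincipal solution *)
Lemma derivative_from_is_derive (R : realType) (t0 t : R) (phi psi : R -> R) :
  derivative_from t0 phi psi -> t0 < t -> is_derive t 1 phi (psi t).
Proof.
move=> dphi tt; have /cvgrPdist_lt lim_ := dphi t (ltW tt).
have cv : h^-1 *: (phi (h *: 1 + t) - phi t) @[h --> 0^'] --> psi t.
  apply/cvgrPdist_lt => e e0.
  have /nbhs_ballP[r r0 hr] := lim_ e e0.
  have m0 : 0 < Num.min r (t - t0) by rewrite lt_min r0 subr_gt0.
  apply/nbhs_ballP; exists (Num.min r (t - t0)) => //= h.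
  rewrite /ball /= sub0r normrN lt_min => /andP[hr1 ht] h0.
  have := hr (h + t); rewrite /ball /= opprD addrCA subrr addr0 normrN in_itv /= andbT.
  move=> /(_ hr1) H; rewrite scaler1 -[_ *: _]/(_ * _) mulrC.
  have -> : h^-1 = (h + t - t)^-1 by rewrite addrK.
  apply: H.
    by apply: contra h0 => /eqP hE; apply/eqP; lra.
  by move: ht; rewrite ltr_norml => /andP[]; lra.
apply: DeriveDef; first by apply/cvg_ex; exists (psi t).
exact/cvg_lim.
Qed.

(** With u a solution of u'' + q u = 0 that has no zero on [T, +oo[, z is u' / u and
    p is u ^- 2. That the primitive r of p stays bounded above says that u ^- 2
    is integrable at infinity, which characterizes the nonprincipal
    solutions. *)
Definition nonprincipal_riccati (R : realType) (T : R) (q z p r : R -> R) :=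
  [/\ forall b, T <= b -> ac_on T b z,
      {ae @lebesgue_measure R, forall t, T < t ->
         is_derive t 1 z (- (q t + z t ^+ 2))},
      forall t, T <= t -> is_derive t 1 p (- (2 * z t * p t)),
      forall t, T <= t -> is_derive t 1 r (p t) &
      forall t, T <= t -> 0 < p t /\ r t <= 0].

(** From one solution phi without zeros, reduction of order gives u = phi * S with
    S' = phi ^- 2. Starting the integral at t1 with S = 1 keeps S away from 0, and
    r = - 1 / S has derivative phi ^- 2 / S ^ 2 = u ^- 2. Everything is stated from
    t1 + 1 on, where the derivatives are two-sided. *)
Lemma nonoscillatory_nonprincipal_riccati (R : realType) (t0 t1 : R)
    (q phi : R -> R) : t0 < t1 -> is_solution t0 q phi ->
  (forall t, t1 <= t -> phi t != 0) ->
  exists T z p r, t0 < T /\ nonprincipal_riccati T q z p r.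
Proof.
move=> t01 [psi [dphi acpsi eqn]] phi0.
have phiD t : t0 < t -> is_derive t 1 phi (psi t).
  exact: derivative_from_is_derive.
pose w t := (phi t * phi t)^-1.
have wD t : t1 <= t -> is_derive t 1 w (- (2 * psi t / phi t * w t)).
  move=> tt; have pt := phi0 t tt; have pD := phiD t (lt_le_trans t01 tt).
  apply: is_derive_eq.
    by apply: (is_derive1V _ (is_derive1M pD pD)); rewrite mulf_neq0.
  by rewrite /w; field.
have wgt0 t : t1 <= t -> 0 < w t.
  by move=> tt; rewrite /w invr_gt0 -expr2 exprn_even_gt0 //= phi0.
have intw u : (@lebesgue_measure R).-integrable `[t1, u] (EFin \o w).
  apply: continuous_compact_integrable; first exact: segment_compact.
  apply: within_continuous_for => x /=; rewrite in_itv /= => /andP[tx _].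
  exact: is_derive_continuous (wD x tx).
pose S t := 1 + \int[lebesgue_measure]_(x in `[t1, t]) w x.
have SD t : t1 < t -> is_derive t 1 S (w t).
  move=> tt; have tu : t < t + 1 by rewrite ltrDl.
  have [dI IE] := continuous_FTC1_closed tu (intw (t + 1)) tt
    (is_derive_continuous (wD t (ltW tt))).
  apply: is_derive_eq.
    by apply: (is_derive1D (is_derive_cst _ _ _) (DeriveDef dI _)); rewrite -derive1E.
  by rewrite IE add0r.
have S1 t : 1 <= S t.
  rewrite lerDl; apply: Rintegral_ge0 => x /=; rewrite in_itv /= => /andP[tx _].
  exact/ltW/wgt0.
have S0 t : S t != 0 by rewrite gt_eqF // (lt_le_trans ltr01).
pose z t := psi t * (phi t)^-1 + w t * (S t)^-1.
pose p t := w t * (S t * S t)^-1.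
pose r t := - (S t)^-1.
pose T := t1 + 1.
have t1T t : T <= t -> t1 < t by rewrite /T => ?; lra.
exists T, z, p, r; split; first by rewrite /T; lra.
split.
- move=> b Tb.
  have acpsiT : ac_on T b psi.
    apply: (@ac_on_sub _ t0 b) => //; first by rewrite /T; lra.
    by apply/abs_continuous_on_ac/acpsi; rewrite /T in Tb; lra.
  have [M M0 hM] := ac_on_bounded Tb acpsiT.
  have acphi : ac_on T b phi.
    apply: (ac_on_bounded_derive (df := psi) _ hM) => t Tt _.
    by apply: phiD; rewrite (lt_trans t01) ?t1T.
  have phi0T t : T <= t -> t <= b -> phi t != 0 by move=> /t1T/ltW/phi0.
  have acw : ac_on T b w.
    apply: ac_onV => //; first exact: ac_onM.
    by move=> t Tt tb; rewrite mulf_neq0 // phi0T.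
  have [N N0 hN] := ac_on_bounded Tb acw.
  have acS : ac_on T b S.
    by apply: (ac_on_bounded_derive (df := w) _ hN) => t Tt _; exact/SD/t1T.
  by apply: ac_onD; apply: ac_onM => //; exact: ac_onV.
- apply: filterS eqn => t ht Tt; have tt := t1T t (ltW Tt).
  have [dpsi psiE] := ht (lt_trans t01 tt).
  have psiD : is_derive t 1 psi (- (q t * phi t)).
    by apply: (DeriveDef dpsi); rewrite -derive1E; lra.
  have pt := phi0 t (ltW tt).
  apply: is_derive_eq.
    exact: is_derive1D
      (is_derive1M psiD (is_derive1V pt (phiD t (lt_trans t01 tt))))
      (is_derive1M (wD t (ltW tt)) (is_derive1V (S0 t) (SD t tt))).
  rewrite /z /w; field; by rewrite pt S0.
- move=> t /t1T tt; have pt := phi0 t (ltW tt).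
  apply: is_derive_eq.
    apply: (is_derive1M (wD t (ltW tt))
      (is_derive1V _ (is_derive1M (SD t tt) (SD t tt)))).
    by rewrite mulf_neq0.
  rewrite /p /z /w; field; by rewrite pt S0.
- move=> t /t1T tt; apply: is_derive_eq.
    exact: is_deriveN (is_derive1V (S0 t) (SD t tt)).
  by rewrite /p; field; rewrite S0.
- move=> t /t1T tt; split.
    by rewrite mulr_gt0 ?wgt0 ?ltW // invr_gt0 mulr_gt0 // (lt_le_trans ltr01).
  by rewrite oppr_le0 invr_ge0 (le_trans ler01).
Qed.

(** * The weighted Riccati inequality *)
Lemma eq_ac_on (R : realType) (a b : R) (f g : R -> R) :
  (forall x, a <= x -> x <= b -> f x = g x) -> ac_on a b f -> ac_on a b g.
Proof.
move=> fg acf; apply: (ac_on_dominated (C := 1) acf acf) => x y ax xy yb.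
rewrite !fg ?(le_trans ax xy) ?(le_trans xy yb) // mul1r.
by rewrite lerDl.
Qed.

(** The Borel representative h of g depends on b, but has the same integral as g on
    every subinterval. *)
Lemma lebesgue_integrable_indefinite (R : realType) (a b : R) (g : R -> R) :
  lebesgue_integrable `[a, b] g ->
  ac_on a b (fun x => \int[lebesgue_measure]_(t in `[a, x]) g t) /\
  {ae @lebesgue_measure R, forall x, a < x -> x < b ->
    is_derive x 1 (fun x => \int[lebesgue_measure]_(t in `[a, x]) g t) (g x)}.
Proof.
move=> [h [gh inth]].
have GH x : a <= x -> x <= b -> \int[lebesgue_measure]_(t in `[a, x]) h t =
    \int[lebesgue_measure]_(t in `[a, x]) g t.
  move=> ax xb; rewrite /Rintegral; congr fine; apply: integral_ae_eq_nonmeasurable.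
  apply: filterS gh => t /= + tx; rewrite !in_itv /= in tx * => -> //.
  by move: tx => /andP[-> /le_trans->].
split; first exact: eq_ac_on GH (indefinite_integral_ac inth).
have := indefinite_integral_is_derive_ae inth.
apply: filterS2 gh => x ghx dH ax xb.
rewrite ghx /= ?in_itv /= ?(ltW ax) ?(ltW xb) //.
apply: near_eq_is_derive (dH ax xb).
near=> y; apply: GH; apply/ltW; near: y; [exact: lt_nbhsr|exact: lt_nbhsl].
Unshelve. all: by end_near. Qed.

Lemma lebesgue_integrableD (R : realType) (D : set R) (g h : R -> R) :
  measurable D -> lebesgue_integrable D g -> lebesgue_integrable D h ->
  lebesgue_integrable D (fun t => g t + h t).
Proof.
move=> mD [g' [gg' ig]] [h' [hh' ih]]; exists (fun t => g' t + h' t); split.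
  by apply: filterS2 gg' hh' => t gt ht Dt; rewrite gt // ht.
have -> : EFin \o (fun t => g' t + h' t) = ((EFin \o g') \+ (EFin \o h'))%E.
  by apply/funext => t /=; rewrite EFinD.
exact: integrableD.
Qed.

Lemma lebesgue_integrable_acM (R : realType) (a b : R) (c g : R -> R) :
  a <= b -> ac_on a b c -> lebesgue_integrable `[a, b] g ->
  lebesgue_integrable `[a, b] (fun t => c t * g t).
Proof.
move=> ab acc [h [gh ih]]; exists (fun t => c t * h t); split.
  by apply: filterS gh => t gt Dt; rewrite gt.
have -> : EFin \o (fun t => c t * h t) = ((EFin \o c) \* (EFin \o h))%E.
  by apply/funext => t /=; rewrite EFinM.
apply: integrableMr => //.
  apply: subspace_continuous_measurable_fun => //.
  exact: ac_on_within_continuous.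
have [M M0 hM] := ac_on_bounded ab acc.
exists M; split; first exact: num_real.
move=> N MN x /=; rewrite in_itv /= => /andP[ax xb].
exact: le_trans (hM x ax xb) (ltW MN).
Qed.

Section weighted_riccati.
Context (R : realType) (t0 : R) (q f : R -> R).
Hypothesis hq : locally_integrable_from t0 q.
Hypothesis hf : Omega t0 f.

Let g s := 2 * f s * q s - derive1 f s ^+ 2 / (2 * f s).
Let G t := \int[lebesgue_measure]_(s in `[t0, t]) g s.
Let Q t := \int[lebesgue_measure]_(s in `[t0, t]) q s.

Let f_gt0 t : t0 <= t -> 0 < f t. Proof. by have [+ _ _] := hf; exact. Qed.

Let ac_f b : t0 <= b -> ac_on t0 b f.
Proof. by move=> tb; apply/abs_continuous_on_ac; have [_ + _] := hf; exact. Qed.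

Let ac_cst a b c : ac_on a b (fun=> c : R).
Proof.
move=> e e0; exists 1 => // s _ _.
by rewrite big1 // => p _; rewrite subrr normr0.
Qed.

Let int_g b : t0 <= b -> lebesgue_integrable `[t0, b] g.
Proof.
move=> tb; have acf := ac_f tb; have [_ _ hd] := hf.
have ac2f : ac_on t0 b (fun s => 2 * f s) by exact: ac_onM.
have -> : g = fun s => 2 * f s * q s + ((-1) * (2 * f s)^-1) * derive1 f s ^+ 2.
  by apply/funext => s; rewrite /g /=; ring.
apply: lebesgue_integrableD => //.
  by apply: lebesgue_integrable_acM => //; exact: hq.
apply: lebesgue_integrable_acM => //; last exact: hd.
apply: ac_onM => //.
apply: ac_onV => // s ts _; rewrite mulf_neq0 //.
by rewrite gt_eqF // f_gt0.
Qed.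

Lemma ac_on_weighted_mean b : t0 <= b -> ac_on t0 b (fun t => 1 / f t * G t).
Proof.
move=> tb; have -> : (fun t => 1 / f t * G t) = fun t => (f t)^-1 * G t.
  by apply/funext => t; rewrite div1r.
apply: ac_onM => //; last exact: (lebesgue_integrable_indefinite (int_g tb)).1.
by apply: ac_onV => //; [exact: ac_f|move=> t tt _; rewrite gt_eqF // f_gt0].
Qed.

Variables (T : R) (z p r : R -> R).
Hypothesis t0T : t0 < T.
Hypothesis zpr : nonprincipal_riccati T q z p r.

(** Completing the square: the derivative of 2 f z + G is
    - (2 f z - f') ^ 2 / (2 f). This holds where f, z and G are all
    differentiable, which is almost everywhere. *)
Lemma weighted_riccati_nonincreasing x y : T <= x -> x <= y ->
  f y * (z y + z y) + G y <= f x * (z x + z x) + G x.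
Proof.
move=> Tx xy; have Ty := le_trans Tx xy.
have t0y : t0 < y := lt_le_trans t0T Ty.
have t0x : t0 < x := lt_le_trans t0T Tx.
have [acz dz _ _ _] := zpr.
have aczx : ac_on x y z by exact: ac_on_sub Tx _ (acz y Ty).
have [acG dG] := lebesgue_integrable_indefinite (int_g (ltW t0y)).
have acf := ac_f (ltW t0y).
have df := ac_on_derivable_ae t0y acf.
apply: (ac_on_nonincreasing (W := fun t => f t * (z t + z t) + G t) xy).
  apply: ac_onD; last exact: ac_on_sub (ltW t0x) _ acG.
  by apply: ac_onM => //; [exact: ac_on_sub (ltW t0x) _ acf|exact: ac_onD].
apply: filterS3 df dz dG => t + dzt dGt xt ty.
move=> /(_ (lt_trans t0x xt) ty) dft.
have fD : is_derive t 1 f (derive1 f t).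
  by apply: (DeriveDef dft); rewrite derive1E.
have zD := dzt (le_lt_trans Tx xt).
have GD := dGt (lt_trans t0x xt) ty.
have D := is_derive1D (is_derive1M fD (is_derive1D zD zD)) GD.
split; first by have [] := D.
rewrite derive1E; have [_ ->] := D.
have ft : 0 < f t by apply/f_gt0/ltW/(lt_trans t0x).
have -> : f t * (- (q t + z t ^+ 2) + - (q t + z t ^+ 2)) +
    (z t + z t) * derive1 f t + g t =
    - ((2 * f t * z t - derive1 f t) ^+ 2 / (2 * f t)).
  by rewrite /g; field; rewrite gt_eqF.
by rewrite oppr_le0 divr_ge0 ?sqr_ge0 // mulr_ge0 // ltW.
Qed.

(** The derivative of z + Q is - z ^ 2. *)
Lemma riccati_nonincreasing x y : T <= x -> x <= y -> z y + Q y <= z x + Q x.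
Proof.
move=> Tx xy; have Ty := le_trans Tx xy.
have t0y : t0 < y := lt_le_trans t0T Ty.
have t0x : t0 < x := lt_le_trans t0T Tx.
have [acz dz _ _ _] := zpr.
have [acQ dQ] := lebesgue_integrable_indefinite (hq (ltW t0y)).
apply: (ac_on_nonincreasing (W := fun t => z t + Q t) xy).
  apply: ac_onD; last exact: ac_on_sub (ltW t0x) _ acQ.
  exact: ac_on_sub Tx _ (acz y Ty).
apply: filterS2 dz dQ => t dzt dQt xt ty.
have D := is_derive1D (dzt (le_lt_trans Tx xt)) (dQt (lt_trans t0x xt) ty).
split; first by have [] := D.
rewrite derive1E; have [_ ->] := D.
have := sqr_ge0 (z t); lra.
Qed.

(** If 2 f z + G stayed nonnegative, then G / f - 2 Q >= - 2 (z + Q) would be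
    bounded below because z + Q is nonincreasing. So it takes a negative value,
    and keeps negative values afterwards. *)
Lemma weighted_mean_le_riccati :
  limf_einf (fun t : R => (1 / f t * G t - 2 * Q t)%:E) (pinfty_nbhs R) = -oo%E ->
  exists2 t2, T <= t2 & forall t, t2 <= t -> 1 / f t * G t <= - (2 * z t).
Proof.
move=> h7.
have [t2 [Tt2 Z2]] : exists t2, T <= t2 /\ f t2 * (z t2 + z t2) + G t2 < 0.
  apply: contrapT => noZ.
  have : ((- (2 * (z T + Q T)))%:E <= -oo)%E; last by rewrite leeNy_eq.
  rewrite -h7 limf_einfE; apply: le_ereal_sup_tmp.
  exists (ereal_inf ((fun t => (1 / f t * G t - 2 * Q t)%:E) @` `[T, +oo[)).
    exists `[T, +oo[%classic => //; have := nbhs_pinfty_ge (num_real T).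
    by apply: filterS => t; rewrite /= in_itv /= andbT.
  apply: le_ereal_inf_tmp => _ [t + <-]; rewrite /= in_itv /= andbT => Tt.
  rewrite lee_fin.
  have Zt : 0 <= f t * (z t + z t) + G t.
    by rewrite leNgt; apply/negP => Zt; apply: noZ; exists t.
  have ft : 0 < f t by apply/f_gt0/ltW/(lt_le_trans t0T).
  have : - (2 * z t) <= 1 / f t * G t.
    rewrite div1r -ler_pdivrMl ?invr_gt0 // invrK; lra.
  have := riccati_nonincreasing (lexx T) Tt; lra.
exists t2 => // t t2t.
have ft : 0 < f t by apply/f_gt0/ltW/(lt_le_trans t0T)/(le_trans Tt2).
have := weighted_riccati_nonincreasing Tt2 t2t => Zt.
rewrite div1r ler_pdivrMl //; lra.
Qed.

End weighted_riccati.

(** * Convergence of the exponential integral *)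
Lemma integral_derivative_lt_pinfty (R : realType) (T : R) (r p : R -> R) :
  (forall t, T <= t -> is_derive t 1 r (p t)) ->
  (forall t, T <= t -> {for t, continuous p}) ->
  (forall t, T <= t -> 0 <= p t) -> (forall t, T <= t -> r t <= 0) ->
  (\int[lebesgue_measure]_(t in `[T, +oo[) (p t)%:E < +oo)%E.
Proof.
move=> rp cp p0 r0.
have rmono x y : T <= x -> x <= y -> r x <= r y.
  move=> Tx xy; have [||c /[!in_itv] /= /andP[xc cy] E] := @MVT_segment _ r p x y xy.
  - by move=> t; rewrite in_itv /= => /andP[xt _]; apply: rp; lra.
  - apply: within_continuous_for => t /=; rewrite in_itv /= => /andP[xt _].
    by apply: (@is_derive_continuous _ _ _ (p t)); apply: rp; lra.
  by rewrite -subr_ge0 E mulr_ge0 ?subr_ge0 // p0 // (le_trans Tx).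
(* The limit theorem for monotone functions needs monotonicity on the whole line;
   freezing r on the left of T provides it. *)
pose rT t := r (Num.max T t).
have cvg_rT : rT t @[t --> +oo] --> sup (range rT).
  apply: nondecreasing_cvgr.
    move=> x y xy; apply: rmono; first by rewrite le_max lexx.
    by rewrite ge_max !le_max lexx xy orbT.
  by exists 0 => _ [t _ <-]; apply: r0; rewrite le_max lexx.
have cvg_r : r t @[t --> +oo] --> sup (range rT).
  apply: cvg_trans cvg_rT; apply: near_eq_cvg; near=> t.
  have Tt : T <= t by near: t; apply: nbhs_pinfty_ge; exact: num_real.
  by rewrite /rT (max_idPr Tt).
rewrite (@ge0_continuous_FTC2y _ p r T _ p0 _ cvg_r) ?ltry //.
- apply: within_continuous_for => t /=; rewrite in_itv /= andbT; exact: cp.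
- by move=> t /ltW/rp[].
- apply: cvg_at_right_filter; exact: is_derive_continuous (rp T (lexx T)).
- move=> t; rewrite in_itv /= andbT => /ltW/rp[_ E].
  by rewrite derive1E E.
Unshelve. all: by end_near. Qed.

(** From t2 on, the logarithmic derivative k of the integrand is at most
    - 2 z = p' / p, so the integrand is at most a constant multiple of p, whose
    integral converges. Before t2, it is bounded. *)
Lemma integral_exp_lt_pinfty (R : realType) (t0 T t2 : R) (q z p r k : R -> R) :
  t0 < T -> nonprincipal_riccati T q z p r -> T <= t2 ->
  (forall b, t0 <= b -> ac_on t0 b k) ->
  (forall t, t2 <= t -> k t <= - (2 * z t)) ->
  (\int[lebesgue_measure]_(t in `[t0, +oo[)
     (expR (\int[lebesgue_measure]_(tau in `[t0, t]) k tau))%:E < +oo)%E.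
Proof.
move=> t0T [_ _ pD rD pr] Tt2 ack kz.
have t02 : t0 < t2 by apply: lt_le_trans Tt2.
pose I t := \int[lebesgue_measure]_(tau in `[t0, t]) k tau.
have intk b : t0 <= b -> (@lebesgue_measure R).-integrable `[t0, b] (EFin \o k).
  move=> tb; apply: continuous_compact_integrable; first exact: segment_compact.
  exact/ac_on_within_continuous/ack.
have ID t : t0 < t -> is_derive t 1 I (k t).
  move=> tt; have tu : t < t + 1 by rewrite ltrDl.
  have t0u : t0 < t + 1 by apply: lt_trans tu.
  have ct : {for t, continuous k}.
    have := ac_on_within_continuous (ack _ (ltW t0u)).
    move=> /(continuous_within_itvP _ t0u)[+ _ _]; apply.
    by rewrite in_itv /= tt tu.
  have [dI IE] := continuous_FTC1_closed tu (intk _ (ltW t0u)) tt ct.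
  by apply: (DeriveDef dI); rewrite -derive1E.
pose E t := expR (I t).
have ED t : t0 < t -> is_derive t 1 E (E t * k t).
  by move=> tt; have It := ID t tt; apply: is_derive1_comp.
have cE t : t0 < t -> {for t, continuous E}.
  by move=> tt; exact: is_derive_continuous (ED t tt).
have pgt0 t : t2 <= t -> 0 < p t.
  by move=> tt; have [] := pr t (le_trans Tt2 tt).
pose K := E t2 / p t2.
have K0 : 0 <= K by rewrite divr_ge0 ?expR_ge0 // ltW ?pgt0.
have EK t : t2 <= t -> E t <= K * p t.
  move=> t2t; rewrite -ler_pdivrMr ?pgt0 //.
  pose W s := E s * (p s)^-1.
  have WD s : t2 <= s -> is_derive s 1 W (W s * (k s + 2 * z s)).
    move=> ts; have ps := pgt0 s ts; have ps0 : p s != 0 by rewrite gt_eqF.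
    have D := is_derive1M (ED s (lt_le_trans t02 ts))
      (is_derive1V ps0 (pD s (le_trans Tt2 ts))).
    by apply: (is_derive_eq D); rewrite /W; field.
  apply: (@ler0_derive1_nincr _ W t2 t _ _ _ t2 t) => //.
  - by move=> s; rewrite in_itv /= => /andP[ts _]; have [] := WD s (ltW ts).
  - move=> s; rewrite in_itv /= => /andP[ts _].
    rewrite derive1E; have [_ ->] := WD s (ltW ts).
    rewrite mulr_ge0_le0 ?divr_ge0 ?expR_ge0 ?(ltW (pgt0 s (ltW ts))) //.
    by have := kz s (ltW ts); lra.
  - apply: within_continuous_for => s /=; rewrite in_itv /= => /andP[ts _].
    exact: is_derive_continuous (WD s ts).
have mE : measurable_fun `[t0, +oo[ E.
  rewrite -(setU1itv false) ?bnd_simp //; apply/measurable_funU => //.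
  split; first exact: measurable_fun_set1.
  apply: open_continuous_measurable_fun; first exact: interval_open.
  by move=> t; rewrite inE /= in_itv /= andbT; exact: cE.
have mE1 : measurable_fun `[t0, t2] E.
  apply: measurable_funS mE => //.
  by apply: subset_itvl; rewrite bnd_simp.
have mE2 : measurable_fun `[t2, +oo[ E.
  apply: measurable_funS mE => //.
  by apply: subset_itvr; rewrite bnd_simp ltW.
have fin1 : (\int[lebesgue_measure]_(t in `[t0, t2]) (E t)%:E < +oo)%E.
  apply: integral_fune_lt_pinfty => //; apply: measurable_bounded_integrable => //.
    by rewrite [ltLHS](lebesgue_measure_itv `[t0, t2]) /= lte_fin t02 ltry.
  have [M M0 hM] := ac_on_bounded (ltW t02) (indefinite_integral_ac (intk _ (ltW t02))).
  exists (expR M); split; first exact: num_real.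
  move=> N MN t /=; rewrite in_itv /= => /andP[tt tt2].
  rewrite ger0_norm ?expR_ge0 // (le_trans _ (ltW MN)) // ler_expR.
  exact: le_trans (ler_norm _) (hM t tt tt2).
have cp t : t2 <= t -> {for t, continuous (fun t => K * p t)}.
  move=> tt; apply: (is_derive_continuous
    (is_derive1M (is_derive_cst K _ _) (pD t (le_trans Tt2 tt)))).
have fin2 : (\int[lebesgue_measure]_(t in `[t2, +oo[) (E t)%:E < +oo)%E.
  apply: (@le_lt_trans _ _ (\int[lebesgue_measure]_(t in `[t2, +oo[) (K * p t)%:E)%E).
    apply: ge0_le_integral => //.
    - by move=> t _; rewrite lee_fin expR_ge0.
    - exact/measurable_EFinP.
    - apply/measurable_EFinP; apply: subspace_continuous_measurable_fun => //.
      by apply: within_continuous_for => t /=; rewrite in_itv /= andbT; exact: cp.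
    - by move=> t /=; rewrite in_itv /= andbT lee_fin; exact: EK.
  apply: (integral_derivative_lt_pinfty (r := fun t => K * r t)) => // t tt.
  - have D := is_derive1M (is_derive_cst K _ _) (rD t (le_trans Tt2 tt)).
    by apply: (is_derive_eq D); rewrite mulr0 addr0.
  - by rewrite mulr_ge0 // ltW // pgt0.
  - by rewrite mulr_ge0_le0 //; have [] := pr t (le_trans Tt2 tt).
have -> : `[t0, +oo[%classic = `[t0, t2]%classic `|` `]t2, +oo[%classic.
  by rewrite -itv_bndbnd_setU ?bnd_simp // ltW.
rewrite ge0_integral_setU //=.
- apply: lte_add_pinfty; first exact: fin1.
  apply: le_lt_trans fin2; apply: ge0_subset_integral => //.
    exact/measurable_EFinP.
  by apply: subset_itvr; rewrite bnd_simp.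
- apply/measurable_EFinP; rewrite -itv_bndbnd_setU ?bnd_simp //; exact/ltW.
- apply/disj_setPRL => t /=; rewrite !in_itv /= andbT => t2t /andP[_].
  by rewrite leNgt t2t.
Qed.

(** A zero-free tail of a solution would make the exponential integral converge. *)
Theorem theorem5 (R : realType) (t0 : R) (q : R -> R)
    (hq : locally_integrable_from t0 q)
    (f : R -> R) (hf : Omega t0 f)
    (h1 : (\int[lebesgue_measure]_(t in `[t0, +oo[)
             (expR (\int[lebesgue_measure]_(tau in `[t0, t])
                (1 / f tau *
                 \int[lebesgue_measure]_(s in `[t0, tau])
                   (2 * f s * q s - derive1 f s ^+ 2 / (2 * f s)))))%R%:E
           = +oo)%E)
    (h7 : limf_einf (fun t : R =>
             (1 / f t *
                \int[lebesgue_measure]_(tau in `[t0, t])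
                  (2 * f tau * q tau - derive1 f tau ^+ 2 / (2 * f tau))
              - 2 * \int[lebesgue_measure]_(tau in `[t0, t]) q tau)%:E)
            (pinfty_nbhs R) = -oo%E) :
  oscillatory t0 q.
Proof.
move=> phi sol M; apply: contrapT => noz.
pose t1 := Num.max t0 M + 1.
have t0m : t0 <= Num.max t0 M by rewrite le_max lexx.
have Mm : M <= Num.max t0 M by rewrite le_max lexx orbT.
have t01 : t0 < t1 by rewrite /t1; lra.
have phi0 t : t1 <= t -> phi t != 0.
  rewrite /t1 => tt; apply/eqP => p0; apply: noz; exists t; split => //; lra.
have [T [z [p [r [t0T zpr]]]]] := nonoscillatory_nonprincipal_riccati t01 sol phi0.
have [t2 Tt2 kz] := weighted_mean_le_riccati hq hf t0T zpr h7.
have := integral_exp_lt_pinfty t0T zpr Tt2 (ac_on_weighted_mean hq hf) kz.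
by rewrite h1 ltxx.
Qed.
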